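(* There exists $t\in\mathbb{R}$ such that the lattice $x_t\in X_3$ satisfies none of the following three alternatives: (1) $Ax_t$ is dense in $X_3$; (2) $Ax_t$ is closed in $X_3$; (3) $Ax_t$ is contained in a closed orbit $Hx_t$, where $H$ is one of the three groups $H_1,H_2,H_3$.
   Context: $X_3$ denotes the space of unimodular (covolume one) lattices in $\mathbb{R}^3$, identified with $SL_3(\mathbb{R})/SL_3(\mathbb{Z})$ (the coset of $g$ corresponds to the lattice spanned by the columns of $g$), on which $SL_3(\mathbb{R})$ acts by left multiplication. $A<SL_3(\mathbb{R})$ is the subgroup of diagonal matrices with positive diagonal entries. For $t\in\mathbb{R}$, $x_t\in X_3$ is the lattice spanned by the columns of $$h_t=\begin{pmatrix}1&0&t\\0&1&t\\0&0&1\end{pmatrix}.$$ $H_1,H_2,H_3$ are the subgroups of $SL_3(\mathbb{R})$ consisting of all matrices in $SL_3(\mathbb{R})$ of the respective forms $$H_1=\begin{pmatrix}*&*&0\\ *&*&0\\0&0&*\end{pmatrix},\quad H_2=\begin{pmatrix}*&0&0\\0&*&*\\0&*&*\end{pmatrix},\quad H_3=\begin{pmatrix}*&0&*\\0&*&0\\ *&0&*\end{pmatrix}.$$ *)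

(* Defs.v *)
From HB Require Import structures.
From mathcomp Require Import all_boot all_order all_algebra.
From mathcomp Require Import all_classical all_reals all_analysis.
Import Order.TTheory GRing.Theory Num.Theory.
Import numFieldNormedType.Exports.

Set Implicit Arguments.
Unset Strict Implicit.
Unset Printing Implicit Defensive.

Local Open Scope classical_set_scope.
Local Open Scope quotient_scope.
Local Open Scope ring_scope.

Section space_of_lattices.
Variable R : realType.

(* SL_3(R) carries the subspace topology of 'M[R]_3, which is the topology of
   entrywise convergence. *)
Definition SL3 : Type := [set g : 'M[R]_3 | \det g = 1].
HB.instance Definition _ := SubType.copy SL3 (set_type _).
HB.instance Definition _ := Topological.copy SL3 (set_type _).

Implicit Types (g h k : SL3) (gamma : 'M[int]_3).

Lemma SL3_det g : \det (val g) = 1.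
Proof. exact: set_mem (valP g). Qed.

Definition SL3_of (M : 'M[R]_3) (detM : \det M = 1) : SL3 := SigSub (mem_set detM).

Lemma SL3_mul_subproof g h : \det (val g *m val h) = 1.
Proof. by rewrite det_mulmx !SL3_det mulr1. Qed.

Definition SL3_mul g h : SL3 := SL3_of (SL3_mul_subproof g h).

Lemma SL3_mulA g h k : SL3_mul g (SL3_mul h k) = SL3_mul (SL3_mul g h) k.
Proof. by apply: val_inj; rewrite /= mulmxA. Qed.

(* g SL_3(Z) = h SL_3(Z) *)
Definition SL3Z_eq g h : bool :=
  `[< exists gamma, \det gamma = 1 /\ val h = val g *m map_mx intr gamma >].

Lemma SL3Z_eq_refl : reflexive SL3Z_eq.
Proof.
by move=> g; apply/asboolP; exists 1%:M; rewrite det1 map_mx1 mulmx1.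
Qed.

Lemma SL3Z_eq_trans : transitive SL3Z_eq.
Proof.
move=> h g k /asboolP[c [c1 hE]] /asboolP[d [d1 kE]].
apply/asboolP; exists (c *m d); split; first by rewrite det_mulmx c1 d1 mulr1.
by rewrite kE hE map_mxM mulmxA.
Qed.

Lemma SL3Z_eq_sym : symmetric SL3Z_eq.
Proof.
suff sub g h : SL3Z_eq g h -> SL3Z_eq h g by move=> g h; apply/idP/idP; exact: sub.
move=> /asboolP[c [c1 hE]]; have uc : c \in unitmx by rewrite unitmxE c1 unitr1.
apply/asboolP; exists (invmx c); split; first by rewrite det_inv c1 invr1.
by rewrite hE -mulmxA -map_mxM mulmxV // map_mx1 mulmx1.
Qed.

Definition SL3Z_equiv := EquivRel SL3Z_eq SL3Z_eq_refl SL3Z_eq_sym SL3Z_eq_trans.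

(* X_3 = SL_3(R) / SL_3(Z) with the quotient topology. *)
Definition X3 : Type := quotient_topology {eq_quot SL3Z_equiv}.
HB.instance Definition _ := Quotient.copy X3 (quotient_topology {eq_quot SL3Z_equiv}).
HB.instance Definition _ := Topological.copy X3 (quotient_topology {eq_quot SL3Z_equiv}).

(* The coset g SL_3(Z), i.e. the lattice spanned by the columns of g. *)
Definition lattice g : X3 := \pi_X3 g.

Lemma lattice_eqP g h :
  lattice g = lattice h <->
  exists gamma, \det gamma = 1 /\ val h = val g *m map_mx intr gamma.
Proof.
split=> [/eqquotP/asboolP //|gh]; by apply/eqquotP/asboolP.
Qed.

Definition X3_act g (x : X3) : X3 := lattice (SL3_mul g (repr x)).

Lemma X3_actE g h : X3_act g (lattice h) = lattice (SL3_mul g h).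
Proof.
have /lattice_eqP[c [c1 hE]] : lattice (repr (lattice h)) = lattice h.
  exact: reprK.
by apply/lattice_eqP; exists c; split=> //=; rewrite hE mulmxA.
Qed.

Definition X3_orbit (H : set SL3) (x : X3) : set X3 := [set X3_act h x | h in H].

Definition A : set SL3 :=
  [set a | is_diag_mx (val a) /\ forall i, 0 < val a i i].

Definition H1 : set SL3 :=
  [set h : SL3 | [/\ val h 0 2 = 0, val h 1 2 = 0, val h 2 0 = 0 & val h 2 1 = 0]].
Definition H2 : set SL3 :=
  [set h : SL3 | [/\ val h 0 1 = 0, val h 0 2 = 0, val h 1 0 = 0 & val h 2 0 = 0]].
Definition H3 : set SL3 :=
  [set h : SL3 | [/\ val h 0 1 = 0, val h 1 0 = 0, val h 1 2 = 0 & val h 2 1 = 0]].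

Definition h_mx (t : R) : 'M[R]_3 :=
  \matrix_(i, j) nth 0 (nth [::] [:: [:: 1; 0; t];
                                     [:: 0; 1; t];
                                     [:: 0; 0; 1]] i) j.

Lemma det_h_mx t : \det (h_mx t) = 1.
Proof.
rewrite -det_tr det_trig; last first.
  by apply/is_trig_mxP=> -[[|[|[|i]]] // ?] [[|[|[|j]]] // ?] //; rewrite !mxE.
by rewrite !big_ord_recl big_ord0 !mxE /= !mulr1.
Qed.

Definition x_ (t : R) : X3 := lattice (SL3_of (det_h_mx t)).

End space_of_lattices.

Arguments A {R}.
Arguments H1 {R}.
Arguments H2 {R}.
Arguments H3 {R}.

(* Main.v *)
Require Import Defs.
From mathcomp Require Import all_boot all_order all_algebra.
From mathcomp Require Import all_classical all_reals all_analysis.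
From mathcomp Require Import ring lra zify.


(** The number [t] = sqrt 2 works; write [s] for sqrt 2. The vectors of [x_ s]
are (m + s k, n + s k, k) with m, n, k integers.

The orbit [A x_t] is not dense, for any [t]. If [a] in [A] has diagonal
(a0, a1, a2), then the lattice [a x_t] contains a0 e_0 and a1 e_1. When both a0
and a1 are large, a vector (a0 (m + t k), a1 (n + t k), a2 k) of bounded length
has |m - n| < 1, hence m = n, so that the vectors of bounded length all lie in
one plane. A lattice that has a basis of short vectors but no short vector on
the first two coordinate axes is therefore not in [A x_t]; the matrix [ref_mx]
and all matrices close to it generate such lattices
([A_h_not_close_to_ref], [A_orbit_not_dense]).

The orbit [A x_s] accumulates outside of itself. Multiplication by the unit
3 + 2 s of norm 1 preserves the ring Z[s]. Hence the elements diag((3 + 2 s)^n,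
1, (3 - 2 s)^n) of [A] move [x_s] along a continuous curve of lattices,
[lattice (curve u)] with u = (3 - 2 s)^n ([curve_in_orbit]), which tends to
[lattice (curve 0)] since 0 < 3 - 2 s < 1. That lattice thus belongs to every
closed set containing [A x_s] ([curve0_in_closed]).

Finally [lattice (curve 0)] is in none of the orbits [H_i x_s]: each of these
orbits would force, by irrationality of s, an integer matrix of determinant 1
to have determinant 0 ([curve0_notin_H1], [curve0_notin_H2],
[curve0_notin_H3]). Since [A] is a subgroup of [H1], neither [A x_s] nor any
[H_i x_s] containing it is closed. *)

Set Implicit Arguments.
Unset Strict Implicit.
Unset Printing Implicit Defensive.

Import Order.TTheory GRing.Theory Num.Theory.
Import numFieldNormedType.Exports.

Local Open Scope classical_set_scope.
Local Open Scope ring_scope.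

(** * Matrices of size 3 *)

Lemma ord3_ind (P : 'I_3 -> Prop) : P 0 -> P 1 -> P 2 -> forall i, P i.
Proof.
move=> P0 P1 P2 [[|[|[|i]]] // lti].
- by rewrite (_ : Ordinal lti = 0) //; apply: val_inj.
- by rewrite (_ : Ordinal lti = 1) //; apply: val_inj.
- by rewrite (_ : Ordinal lti = 2) //; apply: val_inj.
Qed.

Lemma sum_ord3 (V : nmodType) (F : 'I_3 -> V) : \sum_i F i = F 0 + F 1 + F 2.
Proof.
rewrite !big_ord_recl big_ord0 addr0 addrA.
by congr (_ + F _ + F _); apply: val_inj.
Qed.

Lemma mulmx3E (S : pzRingType) m n (M : 'M[S]_(m, 3)) (N : 'M[S]_(3, n)) i j :
  (M *m N) i j = M i 0 * N 0 j + M i 1 * N 1 j + M i 2 * N 2 j.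
Proof. by rewrite mxE sum_ord3. Qed.

Lemma det3E (S : comPzRingType) (M : 'M[S]_3) :
  \det M = M 0 0 * (M 1 1 * M 2 2 - M 1 2 * M 2 1)
         - M 0 1 * (M 1 0 * M 2 2 - M 1 2 * M 2 0)
         + M 0 2 * (M 1 0 * M 2 1 - M 1 1 * M 2 0).
Proof.
have lift0 (k : 'I_3) : lift k (0 : 'I_2) = if k == 0 then 1 else 0.
  by elim/ord3_ind: k; apply: val_inj.
have lift1 (k : 'I_3) : lift k (1 : 'I_2) = if k == 2 then 1 else 2.
  by elim/ord3_ind: k; apply: val_inj.
have det2E (N : 'M[S]_2) : \det N = N 0 0 * N 1 1 - N 0 1 * N 1 0.
  rewrite (expand_det_row _ 0) !big_ord_recl big_ord0 addr0 /cofactor.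
  rewrite !det_mx11 !mxE /= expr0 expr1 mul1r mulN1r mulrN.
  by congr (N _ _ * N _ _ - N _ _ * N _ _); apply: val_inj.
rewrite (expand_det_row _ 0) sum_ord3 /cofactor !det2E !mxE !(lift0, lift1) /=.
by rewrite expr0 expr1 -signr_odd expr0; ring.
Qed.

(** The matrix with the given list of rows. The default value [x0] is irrelevant
as soon as there are three rows of three entries. *)
Definition mx3 (S : Type) (x0 : S) (rows : seq (seq S)) : 'M[S]_3 :=
  \matrix_(i, j) nth x0 (nth [::] rows i) j.

(** * Continuity of matrix-valued maps *)

Lemma mx_continuous (T U : topologicalType) m n (f : T -> 'M[U]_(m, n)) :
  (forall i j, continuous (fun x => f x i j)) -> continuous f.
Proof.
move=> cf x B [P nP PB]; rewrite nbhs_filterE.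
have : \forall y \near x, forall i j, P i j (f y i j).
  by apply: filter_forall => i; apply: filter_forall => j; exact/cf/nP.
by apply: filterS => y Py; exact: PB.
Qed.

Lemma mulmxr_continuous {K : numFieldType} m n p (N : 'M[K]_(n, p)) :
  continuous (fun M : 'M[K]_(m, n) => M *m N).
Proof.
apply: mx_continuous => i j.
rewrite (_ : (fun _ => _) = fun M : 'M[K]_(m, n) => \sum_k M i k * N k j); last first.
  by apply/funext => M; rewrite mxE.
apply: continuous_big => [|k _ M]; first exact: add_continuous.
apply: continuousM; [exact: coord_continuous|exact: cst_continuous].
Qed.

(** * Irrationality of the square root of two *)

Lemma sqrt2_int_free (R : rcfType) (m k : int) :
  m%:~R + Num.sqrt 2 * k%:~R = 0 :> R -> m = 0 /\ k = 0.
Proof.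
move=> mk0.
have s2 : Num.sqrt 2 ^+ 2 = 2 :> R by rewrite sqr_sqrtr.
have /eqP : (m%:~R ^+ 2 = 2 * k%:~R ^+ 2 :> R).
  by rewrite -s2 -exprMn -[Num.sqrt 2 * _](addKr m%:~R) mk0 addr0 sqrrN.
rewrite -!rmorphXn /= -(intrM R 2) eqr_int => /eqP mk2.
suff k0 : k = 0.
  by split => //; move: mk2; rewrite k0 mulr0 => /eqP; rewrite sqrf_eq0 => /eqP.
apply/eqP; apply: contraT => k0.
have m0 : m != 0.
  by apply: contraNneq k0 => m0; move: mk2; rewrite m0 => /eqP; lia.
(* The 2-adic valuation is even on the left-hand side and odd on the right. *)
have : (`|m| ^ 2 = 2 * `|k| ^ 2)%N by lia.
move=> /(congr1 (logn 2)); rewrite lognM ?expn_gt0 ?absz_gt0 ?k0 // !lognX.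
by rewrite (pfactorK 1) //; lia.
Qed.

(** * Orbits of A are not dense *)

Lemma A_offdiag (R : realType) (a : SL3 R) : A a ->
  (val a 0 1 = 0) * (val a 0 2 = 0) * (val a 1 0 = 0) *
  (val a 1 2 = 0) * (val a 2 0 = 0) * (val a 2 1 = 0).
Proof. by move=> [/is_diag_mxP aD _]; rewrite !aD. Qed.

Section not_dense.
Variable R : realType.
Implicit Types g : 'M[R]_3.

(** A matrix of determinant 1 with orthogonal rows. Its first two rows have
entries of absolute value at most 1, while the first two columns of its inverse
are (1, 1, 1) / 3 and (1, -1, 0) / 2: an integer vector that it maps to a e_0
(resp. a e_1), with a > 0, has a >= 3 (resp. a >= 2). As 1/3 + 1/2 < 1, there is
room for a small perturbation. *)
Definition ref_mx : 'M[R]_3 :=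
  mx3 0 [:: [:: 1; 1; 1]; [:: 1; -1; 0]; [:: 6^-1; 6^-1; - 3^-1]].

Lemma det_ref_mx : \det ref_mx = 1.
Proof. by rewrite det3E !mxE /=; field. Qed.

(** The open neighbourhood of [ref_mx] of the matrices whose entries differ by
less than 1/100 from those of [ref_mx]. *)
Definition close_to_ref : set 'M[R]_3 :=
  [set g | forall i j, `|g i j - ref_mx i j| < 100^-1].

Lemma close_to_ref_open : open close_to_ref.
Proof.
rewrite openE => g /= gc.
exists (fun i j => [set x | `|x - ref_mx i j| < 100^-1]) => // i j.
have cf : `|x - ref_mx i j| @[x --> g i j] --> `|g i j - ref_mx i j|.
  by apply: cvg_norm; apply: cvgB; [exact: cvg_id|exact: cvg_cst].
exact: (cvgr_lt _ cf _ (gc i j)).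
Qed.

Lemma close_to_ref_apply g (x : 'cV[R]_3) i : close_to_ref g ->
  `|(g *m x) i 0 - (ref_mx *m x) i 0| <=
    100^-1 * (`|x 0 0| + `|x 1 0| + `|x 2 0|).
Proof.
move=> gc; have -> : (g *m x) i 0 - (ref_mx *m x) i 0 =
    \sum_j (g i j - ref_mx i j) * x j 0.
  by rewrite !mxE -sumrB; apply: eq_bigr => j _; rewrite mulrBl.
rewrite -(sum_ord3 (fun j => `|x j 0|)) mulr_sumr.
apply: le_trans (ler_norm_sum _ _ _) _; apply: ler_sum => j _.
by rewrite normrM ler_wpM2r // ltW.
Qed.

Lemma int_col_large (v : 'cV[int]_3) : v != 0 ->
  exists i, 1 <= `|(map_mx intr v : 'cV[R]_3) i 0|.
Proof.
move=> v0; apply/existsP; apply: contraNT v0 => /existsPn v0.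
apply/eqP/matrixP => i j; rewrite ord1 [RHS]mxE; apply/eqP.
move: (v0 i); rewrite mxE -ltNge -intr_norm ltrz1.
by rewrite -(add0r 1) ltzD1 normr_le0.
Qed.

(** A nonzero integer vector that [g] maps to the axis of e_0 has a long image:
[a] is at least 3 (1 - 7/100). *)
Lemma close_to_ref_axis0 g (v : 'cV[int]_3) a : close_to_ref g -> v != 0 ->
  0 < a -> g *m map_mx intr v = a *: delta_mx 0 0 -> 279 / 100 <= a.
Proof.
move=> gc v0 a0 gv; have [k] := int_col_large v0.
have := close_to_ref_apply (map_mx intr v) 2 gc.
have := close_to_ref_apply (map_mx intr v) 1 gc.
have := close_to_ref_apply (map_mx intr v) 0 gc.
rewrite gv !mulmx3E.
move: (map_mx intr v) => x; rewrite !mxE /=.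
move sE: (`|x 0 0| + `|x 1 0| + `|x 2 0|) => s; rewrite !ler_norml => e0 e1 e2 xk.
(* Apply the inverse of ref_mx, whose rows have l^1 norm at most 7/3, to the
   error vector, whose entries are at most s / 100. *)
have bd i : `|x i 0| <= a / 3 + 7 / 300 * s.
  by elim/ord3_ind: i; rewrite ler_norml; lra.
have s_le : s <= a + 7 / 100 * s.
  by have := bd 0; have := bd 1; have := bd 2; lra.
have := bd k; lra.
Qed.

(** The analogue for the axis of e_1: [a] is at least 2 (1 - 7/100). *)
Lemma close_to_ref_axis1 g (v : 'cV[int]_3) a : close_to_ref g -> v != 0 ->
  0 < a -> g *m map_mx intr v = a *: delta_mx 1 0 -> 186 / 100 <= a.
Proof.
move=> gc v0 a0 gv; have [k] := int_col_large v0.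
have := close_to_ref_apply (map_mx intr v) 2 gc.
have := close_to_ref_apply (map_mx intr v) 1 gc.
have := close_to_ref_apply (map_mx intr v) 0 gc.
rewrite gv !mulmx3E.
move: (map_mx intr v) => x; rewrite !mxE /=.
move sE: (`|x 0 0| + `|x 1 0| + `|x 2 0|) => s; rewrite !ler_norml => e0 e1 e2 xk.
have bd i : `|x i 0| <= a / 2 + 7 / 300 * s.
  by elim/ord3_ind: i; rewrite ler_norml; lra.
have s_le : s <= a + 7 / 100 * s.
  have : `|x 2 0| <= 7 / 300 * s by rewrite ler_norml; lra.
  by have := bd 0; have := bd 1; lra.
have := bd k; lra.
Qed.

(** No lattice of the orbit [A x_t] has a basis close to [ref_mx]: otherwise the
first two rows of the integer matrix [c] would be equal. *)
Lemma A_h_not_close_to_ref (a : SL3 R) t (c : 'M[int]_3) : A a -> \det c = 1 ->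
  ~ close_to_ref (val a *m h_mx t *m map_mx intr c).
Proof.
move=> Aa c1 gc; have aE := A_offdiag Aa; have a0 := Aa.2; set g := _ *m _ in gc.
have uc : c \in unitmx by rewrite unitmxE c1 unitr1.
have v0 j : invmx c *m delta_mx j 0 != 0 :> 'cV_3.
  apply/eqP => /(congr1 (mulmx c)); rewrite mulmxA mulmxV // mul1mx mulmx0.
  by move/matrixP => /(_ j 0); rewrite !mxE !eqxx.
have gv j : g *m map_mx intr (invmx c *m delta_mx j 0 : 'cV_3) =
    val a *m h_mx t *m delta_mx j 0.
  by rewrite /g -[LHS]mulmxA -map_mxM mulmxA mulmxV // mul1mx map_delta_mx.
(* The vectors a0 e_0 and a1 e_1 of the lattice have preimages under g that
   are nonzero integer vectors. *)
have a0_ge : 279 / 100 <= val a 0 0.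
  apply: (close_to_ref_axis0 gc (v0 0)) => //; rewrite gv.
  apply/matrixP => i j; rewrite ord1 {j}.
  by elim/ord3_ind: i; rewrite !mulmx3E !mxE /= ?aE; ring.
have a1_ge : 186 / 100 <= val a 1 1.
  apply: (close_to_ref_axis1 gc (v0 1)) => //; rewrite gv.
  apply/matrixP => i j; rewrite ord1 {j}.
  by elim/ord3_ind: i; rewrite !mulmx3E !mxE /= ?aE; ring.
have c01 j : c 0 j = c 1 j.
  have g0E : g 0 j = val a 0 0 * ((c 0 j)%:~R + t * (c 2 j)%:~R).
    by rewrite /g !mulmx3E !mxE /= !aE; ring.
  have g1E : g 1 j = val a 1 1 * ((c 1 j)%:~R + t * (c 2 j)%:~R).
    by rewrite /g !mulmx3E !mxE /= !aE; ring.
  have g_le i : `|g i j| <= 101 / 100.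
    have /(_ j) : forall k, `|ref_mx i k| <= 1.
      by elim/ord3_ind: i; elim/ord3_ind; rewrite mxE ler_norml /=; lra.
    by have := gc i j; rewrite ler_norml ltr_norml ler_norml; lra.
  (* 101/100 divided by 279/100 and by 186/100 is less than 2/5 and 11/20. *)
  have d1 : `|c 0 j - c 1 j| < 1.
    rewrite -(ltrz1 R) intr_norm intrB.
    have -> : (c 0 j)%:~R - (c 1 j)%:~R =
        g 0 j / val a 0 0 - g 1 j / val a 1 1 :> R.
      by rewrite g0E g1E; field; rewrite !gt_eqF.
    have e0 : `|g 0 j / val a 0 0| <= 2 / 5.
      rewrite normrM normfV (gtr0_norm (a0 _)) ler_pdivrMr //.
      by have := g_le 0; lra.
    have e1 : `|g 1 j / val a 1 1| <= 11 / 20.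
      rewrite normrM normfV (gtr0_norm (a0 _)) ler_pdivrMr //.
      by have := g_le 1; lra.
    by apply: le_lt_trans (ler_normB _ _) _; lra.
  by apply/eqP; rewrite -subr_eq0 -normr_le0 -ltzD1 add0r.
have : \det c = 0 by rewrite det3E !c01; ring.
by rewrite c1.
Qed.

(** The lattices with a basis in an open set [W] of matrices form an open set:
their preimage in SL_3(R) is the union of the translates of [W] by SL_3(Z). *)
Lemma lattice_image_open (W : set 'M[R]_3) : open W ->
  open [set x : X3 R | exists2 g, lattice g = x & W (val g)].
Proof.
move=> Wo.
suff piW : @lattice R @^-1` [set x | exists2 g, lattice g = x & W (val g)] =
    \bigcup_(c in [set c : 'M[int]_3 | \det c = 1])
      [set g : SL3 R | W (val g *m map_mx intr c)].
  rewrite /open /= /quotient_open -/(lattice (R := R)) piW.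
  apply: bigcup_open => c _.
  exists ((fun M : 'M[R]_3 => M *m map_mx intr c) @^-1` W) => //.
  by move/continuousP: (@mulmxr_continuous R 3 3 3 (map_mx intr c)); exact.
apply/seteqP; split => g /=.
  by move=> [h /esym/lattice_eqP[c [c1 ->]]]; exists c.
move=> [c /= c1 Wgc].
have dgc : \det (val g *m map_mx intr c) = 1.
  by rewrite det_mulmx SL3_det det_map_mx c1 mulr1.
by exists (SL3_of dgc) => //; apply/esym/lattice_eqP; exists c.
Qed.

Lemma A_orbit_not_dense (t : R) : ~ dense (X3_orbit A (x_ t)).
Proof.
move=> /(_ _ _ (lattice_image_open close_to_ref_open))[].
  exists (lattice (SL3_of det_ref_mx)); exists (SL3_of det_ref_mx) => // i j.
  by rewrite subrr normr0 invr_gt0.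
move=> x [[g <- gc] [a Aa]]; rewrite X3_actE => /lattice_eqP[c [c1 gE]].
by apply: (A_h_not_close_to_ref Aa c1 (t := t)); rewrite gE in gc.
Qed.

End not_dense.

(** * An accumulation point of the orbit of A *)

Section escape.
Variable R : realType.
Local Notation s := (Num.sqrt 2 : R).

Let s2 : s ^+ 2 = 2. Proof. by rewrite sqr_sqrtr. Qed.

(** The basis of diag(u^-1, 1, u) [x_s] that corresponds, for u = (3 - 2 s)^n, to
the basis of Z[s] obtained from (1, s) by multiplication by u. Its entries remain
polynomial in u, and the value at u = 0 generates a lattice without nonzero
vectors on the axes of e_0 and e_2. *)
Definition curve_mx (u : R) : 'M[R]_3 :=
  mx3 0 [:: [:: 1; 0; s];
            [:: u - 1; 1; u * s];
            [:: (u ^+ 2 - 1) * s / 4; 0; (u ^+ 2 + 1) / 2]].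

Lemma det_curve_mx u : \det (curve_mx u) = 1.
Proof. by rewrite det3E !mxE /=; field: s2. Qed.

Definition curve u : SL3 R := SL3_of (det_curve_mx u).

Lemma curve_continuous : continuous curve.
Proof.
apply: continuous_comp_initial; apply: mx_continuous => i j.
rewrite (funext (fun u => mxE _ _ i j)) => u.
elim/ord3_ind: i; elim/ord3_ind: j => /=;
  repeat first [exact: cvg_cst | exact: cvg_id | exact: exprn_continuous
               | apply: cvgB | apply: cvgD | apply: cvgM].
Qed.

Lemma x_sqrt2E : x_ s = lattice (curve 1).
Proof.
congr lattice; apply: val_inj; apply/matrixP => i j.
by elim/ord3_ind: i; elim/ord3_ind: j; rewrite !mxE /=; field.
Qed.

(** The diagonal matrix with entries the unit 3 + 2 s, 1, and the conjugate and
inverse 3 - 2 s of that unit. *)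
Definition diag_unit_mx : 'M[R]_3 :=
  mx3 0 [:: [:: 3 + 2 * s; 0; 0]; [:: 0; 1; 0]; [:: 0; 0; 3 - 2 * s]].

Lemma det_diag_unit_mx : \det diag_unit_mx = 1.
Proof. by rewrite det3E !mxE /=; ring: s2. Qed.

Definition diag_unit : SL3 R := SL3_of det_diag_unit_mx.

Lemma unit_gt0 : 0 < 3 - 2 * s.
Proof. by have := s2; have : 0 <= s := sqrtr_ge0 2; nra. Qed.

Lemma unit_lt1 : 3 - 2 * s < 1.
Proof. by have := s2; have : 0 <= s := sqrtr_ge0 2; nra. Qed.

Lemma diag_unit_A : A diag_unit.
Proof.
split=> [|i].
  by apply/is_diag_mxP; elim/ord3_ind; elim/ord3_ind; rewrite //= mxE.
have s0 : 0 <= s by exact: sqrtr_ge0.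
by have := unit_gt0; elim/ord3_ind: i; rewrite mxE /=; lra.
Qed.

(** Acting by [diag_unit] multiplies the parameter of the curve by 3 - 2 s. *)
Lemma diag_unit_curve u :
  X3_act diag_unit (lattice (curve u)) = lattice (curve ((3 - 2 * s) * u)).
Proof.
rewrite X3_actE; apply/lattice_eqP.
(* Change of basis: (m, n, k) goes to (m', n', k') with
   m' + s k' = (3 - 2 s) (m + s k) and n' - m' = n - m. *)
exists (mx3 0 [:: [:: 3; 0; -4]; [:: 2; 1; -4]; [:: -2; 0; 3]]).
split; first by rewrite det3E !mxE /=; ring.
apply/matrixP => i j.
by elim/ord3_ind: i; elim/ord3_ind: j; rewrite !mulmx3E !mxE /=; field: s2.
Qed.

Lemma SL3_mul_A (a b : SL3 R) : A a -> A b -> A (SL3_mul a b).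
Proof.
move=> Aa Ab; have aE := A_offdiag Aa; have bE := A_offdiag Ab.
split=> [|i].
  by apply/is_diag_mxP; elim/ord3_ind; elim/ord3_ind => //= _;
    rewrite mulmx3E ?aE ?bE; ring.
have := mulr_gt0 (Aa.2 i) (Ab.2 i).
by elim/ord3_ind: i; rewrite /= mulmx3E !aE !(mul0r, addr0, add0r).
Qed.

Lemma curve_in_orbit n :
  X3_orbit A (x_ s) (lattice (curve ((3 - 2 * s) ^+ n))).
Proof.
elim: n => [|n [a Aa an]].
  exists (SL3_of (det1 R 3)); last first.
    by rewrite x_sqrt2E X3_actE; congr lattice; apply: val_inj; rewrite /= mul1mx.
  split=> [|i]; first exact: scalar_mx_is_diag.
  by rewrite mxE eqxx.
exists (SL3_mul diag_unit a); first exact: SL3_mul_A diag_unit_A Aa.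
by rewrite exprS -diag_unit_curve -an x_sqrt2E !X3_actE SL3_mulA.
Qed.

Lemma curve0_in_closed (S : set (X3 R)) :
  closed S -> X3_orbit A (x_ s) `<=` S -> S (lattice (curve 0)).
Proof.
move=> Scl AS.
have ucvg : ((3 - 2 * s) ^+ n) @[n --> \oo] --> 0.
  by apply: cvg_expr; rewrite gtr0_norm ?unit_gt0 ?unit_lt1.
have cl : closed ((fun u => lattice (curve u)) @^-1` S).
  apply: preimage_closed => // u _.
  apply: continuous_comp; first exact: curve_continuous.
  exact: pi_continuous.
apply: (closed_cvg _ cl _ _ ucvg).
by apply: nearW => n /=; apply: AS; exact: curve_in_orbit.
Qed.

(** * The accumulation point avoids the orbits of the three groups *)

Lemma curve0_row1 (c : 'M[int]_3) j :
  (curve_mx 0 *m map_mx intr c) 1 j = (c 1 j - c 0 j)%:~R.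
Proof. by rewrite mulmx3E !mxE /= intrB; ring. Qed.

(** The third coordinate of a vector of the limit lattice is, up to a factor, of
the form 2 k - s m, and vanishes only if m = k = 0. *)
Lemma curve0_row2 (c : 'M[int]_3) j :
  (curve_mx 0 *m map_mx intr c) 2 j = 0 -> c 0 j = 0 /\ c 2 j = 0.
Proof.
rewrite mulmx3E !mxE /= => e.
have [] := @sqrt2_int_free R (2 * c 2 j) (- c 0 j); last by lia.
by rewrite intrM intrN; lra.
Qed.

(** Membership of the limit lattice in an orbit, in terms of matrices. *)
Lemma curve0_orbit (H : set (SL3 R)) : X3_orbit H (x_ s) (lattice (curve 0)) ->
  exists h c, [/\ H h, \det c = 1 &
    forall i j, (val h *m h_mx s) i j = (curve_mx 0 *m map_mx intr c) i j].
Proof.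
move=> [h Hh]; rewrite X3_actE => /esym/lattice_eqP[c [c1 /= hE]].
by exists h, c; split=> // i j; rewrite hE.
Qed.

(** For [h] in [H1], the images of e_0 and e_1 have third coordinate 0. *)
Lemma curve0_notin_H1 : ~ X3_orbit H1 (x_ s) (lattice (curve 0)).
Proof.
move=> /curve0_orbit[h [c [[_ _ h20 h21] c1 hE]]].
have [c00 c20] : c 0 0 = 0 /\ c 2 0 = 0.
  by apply: curve0_row2; rewrite -hE mulmx3E !mxE /= h20 h21; ring.
have [c01 c21] : c 0 1 = 0 /\ c 2 1 = 0.
  by apply: curve0_row2; rewrite -hE mulmx3E !mxE /= h20 h21; ring.
have : \det c = 0 by rewrite det3E c00 c20 c01 c21; ring.
by rewrite c1.
Qed.

(** For [h] in [H2], the image of e_0 is on the axis of e_0. *)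
Lemma curve0_notin_H2 : ~ X3_orbit H2 (x_ s) (lattice (curve 0)).
Proof.
move=> /curve0_orbit[h [c [[_ _ h10 h20] c1 hE]]].
have [c00 c20] : c 0 0 = 0 /\ c 2 0 = 0.
  by apply: curve0_row2; rewrite -hE mulmx3E !mxE /= h20; ring.
have c10 : c 1 0 = 0.
  apply/eqP; rewrite -[c 1 0]subr0 -{1}c00 -(intr_eq0 R) -curve0_row1 -hE.
  by apply/eqP; rewrite mulmx3E !mxE /= h10; ring.
have : \det c = 0 by rewrite det3E c00 c20 c10; ring.
by rewrite c1.
Qed.

(** For [h] in [H3], the second coordinates of the columns of [h h_s] are 0, p
and p s, where p is the entry [h 1 1]; as both p and p s are integers, they
vanish. *)
Lemma curve0_notin_H3 : ~ X3_orbit H3 (x_ s) (lattice (curve 0)).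
Proof.
move=> /curve0_orbit[h [c [[_ h10 h12 _] c1 hE]]].
have d0 : c 1 0 - c 0 0 = 0.
  apply/eqP; rewrite -(intr_eq0 R) -curve0_row1 -hE.
  by apply/eqP; rewrite mulmx3E !mxE /= h10; ring.
have [d2 d1] : - (c 1 2 - c 0 2) = 0 /\ c 1 1 - c 0 1 = 0.
  apply: (@sqrt2_int_free R); rewrite intrN -!curve0_row1 -!hE !mulmx3E !mxE /=.
  by rewrite h10 h12; ring.
have c10 : c 1 0 = c 0 0 by lia.
have c11 : c 1 1 = c 0 1 by lia.
have c12 : c 1 2 = c 0 2 by lia.
have : \det c = 0 by rewrite det3E c10 c11 c12; ring.
by rewrite c1.
Qed.

End escape.

Theorem theorem6p2 (R : realType) :
  exists t : R,
    ~ [\/ dense (X3_orbit A (x_ t)),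
          closed (X3_orbit A (x_ t))
        | exists H : set (SL3 R),
            [/\ H = H1 \/ H = H2 \/ H = H3,
                closed (X3_orbit H (x_ t)) &
                X3_orbit A (x_ t) `<=` X3_orbit H (x_ t)]].
Proof.
exists (Num.sqrt 2) => -[|Acl|[H [HE Hcl AH]]].
- exact: A_orbit_not_dense.
- have [a Aa aE] := curve0_in_closed Acl (fun=> id).
  apply: curve0_notin_H1; exists a => //.
  by rewrite /H1 /= !(A_offdiag Aa).
- have := curve0_in_closed Hcl AH.
  case: HE => [->|[->|->]].
  + exact: curve0_notin_H1.
  + exact: curve0_notin_H2.
  + exact: curve0_notin_H3.
Qed.
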